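(* Let $d\ge1$, $p\in(0,\infty)$ and $\gamma\in(0,\infty)$. There exists a constant $C>0$ depending only on $d,p,\gamma$ such that for every $f\in X^{\gamma,p}$ and all $x,y\in\mathbb{R}^d$ with $0<|x-y|<\frac1{36}$, $$|f(x)-f(y)|\le C\,[\log(1/|x-y|)]^{-\gamma}\,\big(L_{\gamma,p}f(x)+L_{\gamma,p}f(y)\big).$$
   Context: Functions are real-valued, measurable and everywhere defined on $\mathbb{R}^d$ (a representative is fixed), and $B_r$ is the open Euclidean ball of radius $r$ centered at the origin. For $p,\gamma\in(0,\infty)$, $X^{\gamma,p}$ is the set of $f\in L^p(\mathbb{R}^d)$ with $$[f]_{X^{\gamma,p}}:=\left(\int_{B_{1/3}}\int_{\mathbb{R}^d}\frac{|f(x+h)-f(x)|^p}{|h|^d}\,\frac{1}{[\log(1/|h|)]^{1-p\gamma}}\,dx\,dh\right)^{1/p}<\infty .$$ For $x\in\mathbb{R}^d$, $$L_{\gamma,p}f(x):=\left(\int_{B_{1/3}}\frac{|f(x+h)-f(x)|^p}{|h|^d}\,\frac{1}{[\log(1/|h|)]^{1-p\gamma}}\,dh\right)^{1/p}\in[0,\infty].$$ *)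

(* Defs.v *)
From HB Require Import structures.
From mathcomp Require Import all_boot all_order all_algebra.
From mathcomp Require Import all_classical all_reals all_analysis.

Set Implicit Arguments.
Unset Strict Implicit.
Unset Printing Implicit Defensive.

Import Order.TTheory GRing.Theory Num.Theory.
Import numFieldNormedType.Exports.

Local Open Scope classical_set_scope.
Local Open Scope ring_scope.

Definition rV_display : measure_display.
Proof. exact. Qed.

(* The canonical sigma-algebra on 'rV[R]_n is the Borel one, generated by the
   coordinate maps; Lebesgue measurability is introduced by completion below. *)
Section borel_rV.
Context {R : realType} {n : nat}.

Definition rV_coord (i : 'I_n) (x : 'rV[R]_n) : R := x ord0 i.

Let rV_set0 : g_sigma_preimage rV_coord set0.
Proof. exact: sigma_algebra0. Qed.

Let rV_setC A : g_sigma_preimage rV_coord A -> g_sigma_preimage rV_coord (~` A).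
Proof. exact: sigma_algebraC. Qed.

Let rV_bigcup (F : _^nat) : (forall i, g_sigma_preimage rV_coord (F i)) ->
  g_sigma_preimage rV_coord (\bigcup_i (F i)).
Proof. exact: sigma_algebra_bigcup. Qed.

HB.instance Definition _ := @isMeasurable.Build rV_display
  'rV[R]_n (g_sigma_preimage rV_coord) rV_set0 rV_setC rV_bigcup.

Lemma measurable_rV_coord i : measurable_fun [set: 'rV[R]_n] (rV_coord i).
Proof.
move=> _ Y mY; rewrite setTI; apply: sub_sigma_algebra => /=.
rewrite -bigcup_seq/=; exists i => /=; first by rewrite mem_index_enum.
by exists Y => //; rewrite setTI.
Qed.

Lemma measurable_fun_rVP d (T : measurableType d) (f : T -> 'rV[R]_n) :
  (forall i, measurable_fun [set: T] (rV_coord i \o f)) ->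
  measurable_fun [set: T] f.
Proof.
move=> mf _ A mA; rewrite setTI.
suff: g_sigma_preimage rV_coord `<=` [set B | measurable (f @^-1` B)].
  exact.
apply: smallest_sub.
  split.
  - by rewrite /= preimage_set0.
  - by move=> B /= mB; rewrite setTD preimage_setC; exact: measurableC.
  - by move=> F mF /=; rewrite preimage_bigcup; exact: bigcupT_measurable.
move=> B; rewrite -bigcup_seq/= => -[i _ [Y mY <-]] /=; rewrite setTI.
by have := mf i measurableT Y mY; rewrite setTI.
Qed.

End borel_rV.

Section lebesgue_rV.
Context {R : realType}.

Definition rV_cons n (x : measurableTypeR R * 'rV[R]_n) : 'rV[R]_n.+1 :=
  row_mx (x.1)%:M x.2 : 'rV[R]_(1 + n).

Lemma rV_cons0 n x : @rV_cons n x ord0 ord0 = x.1.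
Proof.
have -> : ord0 = lshift n (ord0 : 'I_1) by exact/val_inj.
by rewrite /rV_cons (@row_mxEl _ 1 1 n) mxE eqxx mulr1n.
Qed.

Lemma rV_consS n x i : @rV_cons n x ord0 (lift ord0 i) = x.2 ord0 i.
Proof.
have -> : lift ord0 i = rshift 1 i by exact/val_inj.
by rewrite /rV_cons (@row_mxEr _ 1 1 n).
Qed.

Lemma measurable_rV_cons n : measurable_fun setT (@rV_cons n).
Proof.
apply: measurable_fun_rVP => i.
case: (unliftP ord0 i) => [j ->|->].
- rewrite (_ : _ \o _ = rV_coord j \o snd).
    exact: measurableT_comp (measurable_rV_coord j) measurable_snd.
  by apply/funext => x /=; exact: rV_consS.
- rewrite (_ : _ \o _ = fst); first exact: measurable_fst.
  by apply/funext => x /=; exact: rV_cons0.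
Qed.

Section step.
Context n (mu : {measure set 'rV[R]_n -> \bar R}).

Definition lebesgue_step : set 'rV[R]_n.+1 -> \bar R :=
  pushforward (@lebesgue_measure R \x^ mu)%E (@rV_cons n).

Let lebesgue_step0 : lebesgue_step set0 = 0%E.
Proof. by rewrite /lebesgue_step /pushforward preimage_set0 measure0. Qed.

Let lebesgue_step_ge0 A : (0 <= lebesgue_step A)%E.
Proof. exact: (measure_ge0 (@lebesgue_measure R \x^ mu)%E). Qed.

Let lebesgue_step_sigma_additive : semi_sigma_additive lebesgue_step.
Proof.
apply: measure_semi_sigma_additive; exact: measurable_rV_cons.
Qed.

HB.instance Definition _ := isMeasure.Build _ _ _ lebesgue_step
  lebesgue_step0 lebesgue_step_ge0 lebesgue_step_sigma_additive.
End step.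

(* The n-fold product of the one-dimensional Lebesgue measure. *)
Fixpoint borel_lebesgue_rV n : {measure set 'rV[R]_n -> \bar R} :=
  match n with
  | 0 => dirac (0 : 'rV[R]_0)
  | n'.+1 => lebesgue_step (borel_lebesgue_rV n')
  end.

Lemma borel_lebesgue_rV_box n (A : 'I_n -> set (measurableTypeR R)) :
  (forall i, measurable (A i)) ->
  borel_lebesgue_rV n [set x | forall i, A i (x ord0 i)] =
  (\prod_(i < n) lebesgue_measure (A i))%E.
Proof.
elim: n A => [|n IHn] A mA.
  rewrite big_ord0 /= diracE mem_set//; by case.
rewrite big_ord_recl -IHn//.
have mB : measurable [set x : 'rV[R]_n | forall i, A (lift ord0 i) (x ord0 i)].
  rewrite (_ : mkset _ = \big[setI/setT]_(i < n)
      (rV_coord i @^-1` (A (lift ord0 i)))).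
    apply: bigsetI_measurable => i _; rewrite -[X in measurable X]setTI.
    by apply: measurable_rV_coord => //; exact: mA.
  rewrite -bigcap_seq; apply/seteqP; split => x /= Ax i.
    by move=> _; exact: Ax.
  by apply: Ax; rewrite /= mem_index_enum.
rewrite -(product_measure2E _ _ (mA ord0) mB).
congr ((_ \x^ _)%E _); apply/seteqP; split => x /=.
  by move=> Ax; split => [|i]; [rewrite -rV_cons0|rewrite -rV_consS].
move=> [A0 AS] i; case: (unliftP ord0 i) => [j ->|->].
  by rewrite rV_consS.
by rewrite rV_cons0.
Qed.

End lebesgue_rV.

(* 'rV[R]_d with the Lebesgue sigma-algebra: the Caratheodory-measurable sets
   of the outer measure induced by the Borel-Lebesgue measure. *)
Definition lebesgue_space (R : realType) (d : nat) : measurableType _ :=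
  caratheodory_type (mu_ext (@borel_lebesgue_rV R d)).

Definition lebesgue_rV (R : realType) (d : nat) :
    {measure set (lebesgue_space R d) -> \bar R} :=
  @completed_measure_extension _ _ _ (@borel_lebesgue_rV R d).

Lemma lebesgue_rV_complete (R : realType) (d : nat) :
  measure_is_complete (@lebesgue_rV R d).
Proof. exact: measure_is_complete_caratheodory. Qed.

Lemma lebesgue_rV_borel (R : realType) (d : nat) (A : set 'rV[R]_d) :
  measurable A -> lebesgue_rV R d A = borel_lebesgue_rV d A.
Proof. exact: measurable_mu_extE. Qed.

Section Xspace.
Context {R : realType} {d : nat}.
Implicit Types (f : 'rV[R]_d -> R) (x h : 'rV[R]_d).

(* The library norm on 'rV[R]_d is the sup norm. *)
Definition enorm x : R := Num.sqrt (\sum_(i < d) x ord0 i ^+ 2).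

Definition eball (r : R) : set 'rV[R]_d := [set h | enorm h < r].

Definition increment (gamma p : R) f x h : R :=
  `|f (x + h) - f x| `^ p / enorm h ^+ d *
  (1 / (ln (1 / enorm h) `^ (1 - p * gamma))).

Definition Lop (gamma p : R) f x : \bar R :=
  ((\int[lebesgue_rV R d]_(h in eball (1 / 3)) (increment gamma p f x h)%:E)
    `^ (1 / p))%E.

Definition X_seminorm (gamma p : R) f : \bar R :=
  ((\int[lebesgue_rV R d]_(h in eball (1 / 3))
      \int[lebesgue_rV R d]_x (increment gamma p f x h)%:E)
    `^ (1 / p))%E.

Definition Xspace (gamma p : R) : set ('rV[R]_d -> R) :=
  [set f | [/\ measurable_fun [set: lebesgue_space R d] f,
               finite_norm (lebesgue_rV R d) p%:E f &
               (X_seminorm gamma p f < +oo)%E]].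

End Xspace.

(* Main.v *)
(* Let r = |x - y|. For every h with 2r <= |h| and |h|^2 <= r, both h and
   k = x - y + h have modulus between r and r^(1/4), so log(1/|h|) and
   log(1/|k|) are comparable to log(1/r), and the kernels of L f(x) at h and of
   L f(y) at k are both at least c |h|^(-d) log(1/r)^(p gamma - 1). Since
   y + k = x + h, the quasi-triangle inequality bounds |f x - f y|^p times this
   quantity by the sum of the two integrands. The measure |h|^(-d) dh of the
   annulus 2r <= |h| <= r^(1/2) is at least c log(1/r), as disjoint boxes at
   dyadic scales show. Integrating, with translation invariance of the completed
   Lebesgue measure, gives
   |f x - f y|^p log(1/r)^(p gamma) <= C (L f(x)^p + L f(y)^p). *)

Require Import Defs.
From mathcomp Require Import all_boot all_order all_algebra.
From mathcomp Require Import all_classical all_reals all_analysis.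
From mathcomp Require Import measurable_realfun.
From mathcomp Require Import ring lra.

Import Order.TTheory GRing.Theory Num.Theory.
Import numFieldNormedType.Exports.

Local Open Scope classical_set_scope.
Local Open Scope ring_scope.

(** * Translation invariance of the completed Lebesgue measure *)

Section translation.
Context {R : realType}.

Lemma lebesgue_measure_translate (a : R) (A : set (measurableTypeR R)) :
  measurable A ->
  lebesgue_measure ((fun x : measurableTypeR R => a + x) @^-1` A) =
  lebesgue_measure A.
Proof.
move=> mA.
have ma : measurable_fun [set: measurableTypeR R]
    (fun x => (a + x : measurableTypeR R)) by exact: measurable_funD.
apply/esym.
apply: (@lebesgue_measure_unique R (pushforward lebesgue_measure
  (fun x : measurableTypeR R => a + x : measurableTypeR R))) => //.
move=> _ [[b c]] _ <-; rewrite /pushforward.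
have itvE : (fun x : R => a + x) @^-1` `]b, c] = `]b - a, c - a]%classic.
  by apply/seteqP; split => x /=; rewrite !in_itv/= ltrBlDl lerBrDl.
transitivity (lebesgue_measure (`]b - a, c - a]%classic : set R)); last first.
  by rewrite -itvE.
rewrite !lebesgue_measure_itv/= !lte_fin ltrD2r.
by case: ifP => // _; rewrite -!EFinB opprB addrA subrK.
Qed.

Lemma measurable_rV_translate n (v : 'rV[R]_n) :
  measurable_fun [set: 'rV[R]_n] (fun z : 'rV[R]_n => v + z).
Proof.
apply: measurable_fun_rVP => i.
rewrite (_ : _ \o _ = (fun t : R => v ord0 i + t) \o rV_coord i).
  by apply: measurableT_comp; [exact: measurable_funD|exact: measurable_rV_coord].
by apply/funext => z /=; rewrite /rV_coord mxE.
Qed.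

Lemma rV_consD n (v : 'rV[R]_n.+1) (a : R) (z : 'rV[R]_n) :
  v + rV_cons (a, z) =
  rV_cons (v ord0 ord0 + a, \row_i v ord0 (lift ord0 i) + z).
Proof.
apply/rowP => i; rewrite mxE; case: (unliftP ord0 i) => [j ->|->].
  by rewrite !rV_consS/= !mxE.
by rewrite !rV_cons0.
Qed.

(** By induction on [n]: the product measure integrates the one-dimensional measure of the sections,
    which ignores a shift of the head coordinate; the shift of the remaining coordinates is a change
    of variables in the outer integral. *)
Lemma borel_lebesgue_rV_translate n (v : 'rV[R]_n) (A : set 'rV[R]_n) :
  measurable A ->
  borel_lebesgue_rV n ((fun z => v + z) @^-1` A) = borel_lebesgue_rV n A.
Proof.
elim: n v A => [|n IHn] v A mA.
  congr (borel_lebesgue_rV 0 _); apply/seteqP.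
  by split => z /=; rewrite (thinmx0 (v + z)) (thinmx0 z).
rewrite /= /lebesgue_step /pushforward /product_measure2.
set w : 'rV[R]_n := \row_i v ord0 (lift ord0 i).
set B := @rV_cons R n @^-1` A.
have mB : measurable B.
  by rewrite -[B]setTI; apply: measurable_rV_cons.
pose F (y : 'rV[R]_n) := (@lebesgue_measure R (ysection B y)).
have mF : measurable_fun setT F by exact: measurable_fun_ysection.
transitivity (\int[borel_lebesgue_rV n]_y F (w + y)%R)%E.
  apply: eq_integral => y _ /=.
  rewrite /F -(lebesgue_measure_translate (v ord0 ord0) _
    (measurable_ysection (w + y) mB)).
  congr lebesgue_measure; apply/seteqP; split => a;
    by rewrite /ysection /B /= !inE /= rV_consD.
rewrite -(ge0_integral_pushforward (measurable_rV_translate _ w)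
  (borel_lebesgue_rV n) measurableT mF); last by move=> *; exact: measure_ge0.
apply: eq_measure_integral => [|mw C mC _]; first exact: measurable_rV_translate.
exact: IHn.
Qed.

(** Shifting a measurable cover gives a cover of the same total measure; the reverse inequality is
    the same one for [- v]. The equality covers arbitrary sets, which is what Caratheodory's
    criterion calls for. *)
Lemma mu_ext_borel_translate n (v : 'rV[R]_n) (A : set 'rV[R]_n) :
  mu_ext (borel_lebesgue_rV n) ((fun z => v + z) @^-1` A) =
  mu_ext (borel_lebesgue_rV n) A.
Proof.
have le_tr (w : 'rV[R]_n) (B : set 'rV[R]_n) :
    (mu_ext (borel_lebesgue_rV n) ((fun z => w + z)%R @^-1` B) <=
     mu_ext (borel_lebesgue_rV n) B)%E.
  apply: ereal_inf_le_tmp => _ [F [mF BF] <-].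
  exists (fun k => (fun z => w + z) @^-1` F k).
    split=> [k|z /= /BF[k _ Fk]]; last by exists k.
    by rewrite -[X in measurable X]setTI; exact: measurable_rV_translate.
  by apply: eq_eseriesr => k _; exact: borel_lebesgue_rV_translate.
apply/eqP; rewrite eq_le le_tr/=.
have := le_tr (- v) ((fun z => v + z) @^-1` A).
rewrite (_ : _ @^-1` (_ @^-1` A) = A)//.
by apply/seteqP; split => z /=; rewrite addrA subrr add0r.
Qed.

(** The criterion for the preimage of [A] against a test set [X] is the criterion for [A] against
    the shifted set [tX]. *)
Lemma measurable_lebesgue_translate d (v : 'rV[R]_d) :
  measurable_fun [set: lebesgue_space R d]
    (fun z : lebesgue_space R d => v + z : lebesgue_space R d).
Proof.
move=> _ A mA; rewrite setTI.
have {mA} cA : caratheodory_measurable (mu_ext (borel_lebesgue_rV d)) A := mA.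
suff : caratheodory_measurable (mu_ext (borel_lebesgue_rV d))
  ((fun z => v + z) @^-1` A) by [].
move=> X.
pose tX : set 'rV[R]_d := (fun z => - v + z) @^-1` X.
have XE : X = (fun z => v + z) @^-1` tX.
  by apply/seteqP; split => z; rewrite /tX /= addrA addNr add0r.
have := cA tX; rewrite -(mu_ext_borel_translate _ v tX).
rewrite -(mu_ext_borel_translate _ v (tX `&` A)).
by rewrite -(mu_ext_borel_translate _ v (tX `&` ~` A)) XE.
Qed.

Lemma ge0_integral_lebesgue_translate d (v : 'rV[R]_d)
    (D : set (lebesgue_space R d)) (F : lebesgue_space R d -> \bar R) :
  measurable D -> measurable_fun D F -> (forall z, D z -> (0 <= F z)%E) ->
  (\int[lebesgue_rV R d]_(z in D) F z =
   \int[lebesgue_rV R d]_(z in (fun z => (v + z)%R) @^-1` D) F (v + z)%R)%E.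
Proof.
move=> mD mF F0.
rewrite -(ge0_integral_pushforward (measurable_lebesgue_translate _ v)
  (lebesgue_rV R d) mD mF); last by move=> z; rewrite inE => /F0.
apply: eq_measure_integral => [|mv A mA _].
  exact: measurable_lebesgue_translate.
exact/esym/mu_ext_borel_translate.
Qed.

End translation.

(** * Measurability of the Euclidean norm and of the increments *)

Section measurability.
Context {R : realType} {d : nat}.

Lemma measurable_borel_lebesgue (A : set 'rV[R]_d) :
  measurable A -> measurable (A : set (lebesgue_space R d)).
Proof. exact: caratheodory_measurable_mu_ext. Qed.

Lemma measurable_fun_borel_lebesgue (g : 'rV[R]_d -> R) :
  measurable_fun [set: 'rV[R]_d] g ->
  measurable_fun [set: lebesgue_space R d] g.
Proof.
move=> mg _ Y mY; rewrite setTI; apply: measurable_borel_lebesgue.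
by rewrite -[X in measurable X]setTI; exact: mg.
Qed.

(** Inversion is the power of exponent -1, also where [g] vanishes: both then take the value 0. *)
Lemma measurable_fun_inv_ge0 d' (T : measurableType d') (g : T -> R) :
  (forall x, 0 <= g x) -> measurable_fun [set: T] g ->
  measurable_fun [set: T] (fun x => (g x)^-1).
Proof.
move=> g0 mg; rewrite (_ : (fun _ => _) = (fun t => t `^ (-1)) \o g).
  exact: measurableT_comp (measurable_powR _) mg.
by apply/funext => x /=; rewrite powR_inv1.
Qed.

Lemma enorm_ge0 (x : 'rV[R]_d) : 0 <= enorm x.
Proof. exact: sqrtr_ge0. Qed.

Lemma sqr_enorm (x : 'rV[R]_d) : enorm x ^+ 2 = \sum_(i < d) x ord0 i ^+ 2.
Proof. by rewrite sqr_sqrtr// sumr_ge0// => i _; exact: sqr_ge0. Qed.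

Lemma measurable_enorm : measurable_fun [set: 'rV[R]_d] (@enorm R d).
Proof.
rewrite (_ : @enorm R d = (fun t => t `^ 2^-1) \o
    (fun x => \sum_(i < d) rV_coord i x ^+ 2)).
  apply: measurableT_comp (measurable_powR _) _.
  apply: measurable_sum => i.
  by apply: measurable_funX; exact: measurable_rV_coord.
apply/funext => x /=; rewrite powR12_sqrt//.
by rewrite sumr_ge0// => i _; exact: sqr_ge0.
Qed.

Lemma measurable_eball (r : R) :
  measurable (@eball R d r : set (lebesgue_space R d)).
Proof.
apply: measurable_borel_lebesgue; rewrite -[X in measurable X]setTI.
rewrite (_ : _ `&` _ = setT `&` (@enorm R d @^-1` `]-oo, r[)).
  by apply: measurable_enorm => //; exact: measurable_itv.
by congr (_ `&` _); apply/seteqP; split => x /=; rewrite in_itv.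
Qed.

Lemma increment_ge0 (gamma p : R) f (x h : 'rV[R]_d) :
  0 <= increment gamma p f x h.
Proof.
by rewrite /increment mulr_ge0// divr_ge0 ?powR_ge0 ?exprn_ge0 ?enorm_ge0.
Qed.

(** The kernel is Borel in [h], but [f] is only Lebesgue measurable, so the numerator relies on the
    measurability of translations for the completed sigma-algebra. *)
Lemma measurable_increment (gamma p : R) f (x : 'rV[R]_d) :
  measurable_fun [set: lebesgue_space R d] f ->
  measurable_fun [set: lebesgue_space R d] (increment gamma p f x).
Proof.
move=> mf; apply: measurable_funM; last first.
  apply: measurable_fun_borel_lebesgue.
  under eq_fun do rewrite div1r.
  apply: measurable_fun_inv_ge0 => [h|]; first exact: powR_ge0.
  apply: measurableT_comp (measurable_powR _) _.
  apply: measurableT_comp (@measurable_ln R) _.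
  under eq_fun do rewrite div1r.
  by apply: measurable_fun_inv_ge0 => [h|]; [exact: enorm_ge0|exact: measurable_enorm].
apply: measurable_funM; last first.
  apply: measurable_fun_borel_lebesgue.
  apply: measurable_fun_inv_ge0 => [h|]; first by rewrite exprn_ge0// enorm_ge0.
  exact: measurable_funX measurable_enorm.
apply: measurableT_comp (measurable_powR _) _.
apply: measurableT_comp (@normr_measurable R setT) _.
apply: measurable_funB; last exact: measurable_cst.
exact: measurableT_comp mf (measurable_lebesgue_translate _ x).
Qed.

End measurability.

(** * Dyadic boxes: volume, size and disjointness *)

Section box.
Context {R : realType} {n : nat}.
Local Notation d := n.+1.

(* The sides s / d keep |h|^2 <= 5 s^2 whatever d, so that the box at scale 2r
   satisfies |h|^2 <= r as soon as r < 1 / 36. *)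
Definition box (s : R) : set 'rV[R]_d :=
  [set h | forall i : 'I_d,
    (if i == ord0 then `[s, 2 * s[ else `[0, s / d%:R[)%classic (h ord0 i)].

Lemma borel_box (s : R) : measurable (box s).
Proof.
rewrite (_ : box s = \big[setI/setT]_(i < d) (rV_coord i @^-1`
    (if i == ord0 then `[s, 2 * s[ else `[0, s / d%:R[)%classic)).
  apply: bigsetI_measurable => i _; rewrite -[X in measurable X]setTI.
  apply: measurable_rV_coord => //; case: ifP => _; exact: measurable_itv.
rewrite -bigcap_seq; apply/seteqP; split => x /= Ax i.
  by move=> _; exact: Ax.
by apply: Ax; rewrite /= mem_index_enum.
Qed.

Lemma measurable_box (s : R) : measurable (box s : set (lebesgue_space R d)).
Proof. by apply: measurable_borel_lebesgue; exact: borel_box. Qed.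

Lemma lebesgue_box (s : R) : 0 < s ->
  lebesgue_rV R d (box s) = (s ^+ d / d%:R ^+ n)%:E.
Proof.
move=> s0; rewrite lebesgue_rV_borel; last exact: borel_box.
rewrite (borel_lebesgue_rV_box (A := fun i : 'I_d =>
  if i == ord0 then `[s, 2 * s[%classic else `[0, s / d%:R[%classic)); last first.
  by move=> i; case: ifP => _; exact: measurable_itv.
rewrite big_ord_recl eqxx.
rewrite [X in (_ * X)%E](_ : _ = \prod_(i < n) (s / d%:R)%:E)%E; last first.
  apply: eq_bigr => i _; rewrite lebesgue_measure_itv/= lte_fin.
  by rewrite divr_gt0// -EFinB subr0.
rewrite lebesgue_measure_itv/= lte_fin ltr_pMl// ltr1n/=.
rewrite -EFinB mulr2n mulrDl mul1r addrK.
by rewrite prodEFin -EFinM prodr_const card_ord exprMn exprVn mulrA -exprS.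
Qed.

(** The first coordinate contributes between s^2 and 4 s^2, and the [n] others at most s^2 / d each,
    hence at most s^2 together. *)
Lemma box_enorm (s : R) (h : 'rV[R]_d) : 0 < s -> box s h ->
  s ^+ 2 <= enorm h ^+ 2 <= 5 * s ^+ 2.
Proof.
move=> s0 hs; rewrite sqr_enorm big_ord_recl.
have /= := hs ord0; rewrite in_itv/= => /andP[sh0 h0s].
have S0 : 0 <= \sum_(i < n) h ord0 (lift ord0 i) ^+ 2.
  by rewrite sumr_ge0// => i _; exact: sqr_ge0.
have S1 : \sum_(i < n) h ord0 (lift ord0 i) ^+ 2 <= s ^+ 2.
  apply: (@le_trans _ _ (\sum_(i < n) (s ^+ 2 / d%:R))).
    apply: ler_sum => i _.
    have /= := hs (lift ord0 i); rewrite in_itv/= => /andP[hi0 his].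
    apply: (@le_trans _ _ ((s / d%:R) ^+ 2)).
      by apply: lerXn2r; rewrite ?nnegrE ?divr_ge0// ltW.
    rewrite expr_div_n ler_pM2l ?exprn_gt0// lef_pV2 ?posrE ?exprn_gt0//.
    by rewrite -natrX ler_nat expnS leq_pmulr.
  rewrite sumr_const card_ord -[leLHS]mulr_natr -mulrA ler_piMr ?sqr_ge0//.
  by rewrite mulrC ler_pdivrMr// mul1r ler_nat.
by apply/andP; split; nra.
Qed.

Lemma box_disjoint (s t : R) (h : 'rV[R]_d) : 2 * s <= t ->
  box s h -> box t h -> False.
Proof.
move=> st hs ht.
have /= := hs ord0; have /= := ht ord0; rewrite !in_itv/= => /andP[th _] /andP[_ hs2].
by have := lt_le_trans hs2 (le_trans st th); rewrite ltxx.
Qed.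

End box.

(** * Pointwise lower bounds for the kernel and the increments *)

Lemma sqr_enormD_le {R : realType} {d : nat} (u v : 'rV[R]_d) :
  enorm (u + v) ^+ 2 <= 2 * enorm u ^+ 2 + 2 * enorm v ^+ 2.
Proof.
rewrite !sqr_enorm !mulr_sumr -big_split; apply: ler_sum => i _.
rewrite mxE /=; have := sqr_ge0 (u ord0 i - v ord0 i); lra.
Qed.

(** The absolute value in the constant serves both signs of [e], which will be p gamma - 1: the
    bound L / 4 <= l is used for e >= 0, and l <= L for e < 0. *)
Lemma le_powR_scaled {R : realType} (e L l : R) : 0 < L -> L / 4 <= l <= L ->
  4^-1 `^ `|e| * L `^ e <= l `^ e.
Proof.
move=> L0 /andP[Ll lL].
have l0 : 0 < l by apply: lt_le_trans Ll; rewrite divr_gt0.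
have [e0|e0] := leP 0 e.
  rewrite ger0_norm// -powRM ?invr_ge0 ?(ltW L0)//.
 by apply: ge0_ler_powR; rewrite ?nnegrE ?mulr_ge0 ?invr_ge0 1?mulrC// ltW.
rewrite ltr0_norm//; apply: (@le_trans _ _ (L `^ e)).
  rewrite ler_piMl ?powR_ge0//.
  rewrite -[leRHS](powRr0 (4^-1 : R)); apply: ger_powR; first by lra.
  by rewrite oppr_ge0 ltW.
rewrite -[e]opprK !(powRN _ (- e)) lef_pV2 ?posrE ?powR_gt0//.
by apply: ge0_ler_powR; rewrite ?nnegrE ?oppr_ge0 ?(ltW e0) ?(ltW l0) ?(ltW L0).
Qed.

(** The bounds r <= t and t^4 <= r place log(1/t) between log(1/r) / 4 and log(1/r), while t <= 4 s
    controls the power of [t]. *)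
Lemma kernel_lower_bound {R : realType} (d : nat) (p gamma r s t : R) :
  0 < r < 1 / 36 -> 0 < s -> r <= t -> t ^+ 4 <= r -> t <= 4 * s ->
  4^-1 `^ `|p * gamma - 1| * ln (1 / r) `^ (p * gamma - 1) / (4 * s) ^+ d <=
  1 / t ^+ d * (1 / ln (1 / t) `^ (1 - p * gamma)).
Proof.
move=> /andP[r0 r36] s0 rt t4r ts.
have t0 : 0 < t by exact: lt_le_trans rt.
rewrite !div1r mulrC; apply: ler_pM.
- by rewrite invr_ge0 exprn_ge0// mulr_ge0// ltW.
- by rewrite mulr_ge0 ?powR_ge0.
- rewrite lef_pV2 ?posrE ?exprn_gt0 ?mulr_gt0//.
  by apply: lerXn2r; rewrite ?nnegrE ?mulr_ge0// ltW.
rewrite -powRN opprB; apply: le_powR_scaled.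
  by apply: ln_gt0; rewrite invf_gt1//; lra.
apply/andP; split; last by rewrite ler_ln ?posrE ?invr_gt0// lef_pV2.
rewrite ler_pdivrMr// mulr_natr -lnXn ?invr_gt0//.
by rewrite ler_ln ?posrE ?exprn_gt0 ?invr_gt0// exprVn lef_pV2 ?posrE ?exprn_gt0.
Qed.

Lemma exists_number_of_scales {R : realType} (r : R) : 0 < r < 1 / 36 ->
  exists K : nat, ln (1 / r) <= 4 * ln 4 * K%:R /\ 5 * 4 ^+ K * r <= 1.
Proof.
move=> /andP[r0 r36]; have l4 : 0 < ln (4 : R) by apply: ln_gt0; lra.
have q0 : 0 < 1 / (5 * r) by rewrite divr_gt0// mulr_gt0.
(* The number of scales is the integer part of [a], the logarithm of 1 / (5 r) in base 4. Since r <
   1/36, a >= 1, so a is less than twice its integer part. *)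
pose a := ln (1 / (5 * r)) / ln 4.
have q4 : 4 <= 1 / (5 * r) by rewrite ler_pdivlMr ?mulr_gt0//; lra.
have a1 : 1 <= a by rewrite /a ler_pdivlMr// [1 * ln 4]mul1r ler_ln ?posrE.
have aE : a * ln 4 = ln (1 / (5 * r)) by rewrite /a divfK// gt_eqF.
have /andP[Ka aK] : (Num.truncn a)%:R <= a < (Num.truncn a).+1%:R.
  by apply: truncn_itv; lra.
have K1 : 1 <= (Num.truncn a)%:R :> R.
  by rewrite ler1n truncn_gt0.
exists (Num.truncn a); split.
  (* This amounts to 25 r <= 1; it costs a second factor 2, whence the 4 in the statement. *)
  have : ln (1 / r) <= 2 * ln (1 / (5 * r)).
    rewrite mulr_natl -lnXn// ler_ln ?posrE ?exprn_gt0// ?divr_gt0//.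
    rewrite ler_pdivrMr// !div1r exprVn mulrC ler_pdivlMr ?exprn_gt0 ?mulr_gt0//.
    by nra.
  rewrite -aE -natr1 in aK *; nra.
have : 4 ^+ Num.truncn a <= 1 / (5 * r).
  rewrite -ler_ln ?posrE ?exprn_gt0// lnXn// -aE -[leLHS]mulr_natl.
  by rewrite ler_wpM2r// ltW.
by rewrite ler_pdivlMr ?mulr_gt0// mulrA (mulrC _ 5).
Qed.

(** Bounding |a - b| by twice the larger of the two distances works for every p > 0, including p < 1
    where convexity fails. *)
Lemma powR_normB_le {R : realType} (p a b c : R) : 0 < p ->
  2 `^ (- p) * `|a - b| `^ p <= `|c - a| `^ p + `|c - b| `^ p.
Proof.
move=> p0; rewrite powRN mulrC ler_pdivrMr ?powR_gt0//.
have abc : `|a - b| <= `|c - a| + `|c - b|.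
  by rewrite (distrC c a) (le_trans _ (ler_normD _ _))// addrA subrK.
have [ab|ba] := leP `|c - a| `|c - b|.
  apply: (@le_trans _ _ ((`|c - b| * 2) `^ p)).
    by apply: ge0_ler_powR; rewrite ?nnegrE ?mulr_ge0 ?(ltW p0)//; lra.
  by rewrite powRM// ler_wpM2r ?powR_ge0// lerDr powR_ge0.
apply: (@le_trans _ _ ((`|c - a| * 2) `^ p)).
  by apply: ge0_ler_powR; rewrite ?nnegrE ?mulr_ge0 ?(ltW p0)//; lra.
by rewrite powRM// ler_wpM2r ?powR_ge0// lerDl powR_ge0.
Qed.

Lemma increment_box_ge {R : realType} {n : nat} (p gamma : R)
    (f : 'rV[R]_n.+1 -> R) (x y h : 'rV[R]_n.+1) (s : R) :
  0 < p -> 0 < enorm (x - y) < 1 / 36 ->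
  2 * enorm (x - y) <= s -> 5 * s ^+ 2 <= enorm (x - y) -> box s h ->
  [/\ eball (1 / 3) h, eball (1 / 3) (x - y + h) &
   2 `^ (- p) * `|f x - f y| `^ p * (4^-1 `^ `|p * gamma - 1| *
     ln (1 / enorm (x - y)) `^ (p * gamma - 1) / (4 * s) ^+ n.+1) <=
   increment gamma p f x h + increment gamma p f y (x - y + h)].
Proof.
move=> p0 r01 rs sr hs; have /andP[r0 r36] := r01.
have s0 : 0 < s by apply: lt_le_trans rs; rewrite mulr_gt0.
have /andP[h1 h2] := box_enorm s h s0 hs.
have k2 := sqr_enormD_le (x - y) h.
(* Writing h = (x - y + h) + (y - x) bounds the translate from below: u^2 <= 2 t^2 + 2 r^2 and u^2
   >= s^2 >= 4 r^2 give t >= r. *)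
have := sqr_enormD_le (x - y + h) (y - x).
have -> : enorm (y - x) = enorm (x - y).
  rewrite /enorm; congr Num.sqrt; apply: eq_bigr => i _.
  by rewrite !mxE -opprB sqrrN.
rewrite addrAC addrA subrK subrr add0r => k1.
have u0 := enorm_ge0 h; have t0 := enorm_ge0 (x - y + h).
set r := enorm (x - y) in r01 r0 r36 rs sr k1 k2 *.
rewrite /increment /eball /=.
set u := enorm h in h1 h2 k1 k2 u0 *.
set t := enorm (x - y + h) in k1 k2 t0 *.
clearbody r u t.
have rs2 : 4 * r ^+ 2 <= s ^+ 2 by nra.
have rt : r <= t by rewrite -(@ler_pXn2r _ 2) ?nnegrE// ?(ltW r0)//; lra.
have ru : r <= u by rewrite -(@ler_pXn2r _ 2) ?nnegrE// ?(ltW r0)//; lra.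
have u2 : u ^+ 2 <= r by lra.
(* From t^2 <= 2 r^2 + 2 u^2 and u^2 <= r. As r < 1/36, this yields both t^4 <= 9 r^2 <= r and t <
   1/3. *)
have t2 : t ^+ 2 <= 3 * r by nra.
have u4 : u ^+ 4 <= r by rewrite (exprM u 2 2); nra.
have t4 : t ^+ 4 <= r by rewrite (exprM t 2 2); nra.
have us : u <= 4 * s.
  by rewrite -(@ler_pXn2r _ 2) ?nnegrE ?mulr_ge0// ?(ltW s0)// exprMn; nra.
have ts : t <= 4 * s.
  by rewrite -(@ler_pXn2r _ 2) ?nnegrE ?mulr_ge0// ?(ltW s0)// exprMn; nra.
split; [by nra|by nra|].
have Ku := kernel_lower_bound n.+1 p gamma r s u r01 s0 ru u4 us.
have Kt := kernel_lower_bound n.+1 p gamma r s t r01 s0 rt t4 ts.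
set W := (X in _ * X <= _); rewrite -/W in Ku Kt.
have fy : y + (x - y + h) = x + h by rewrite addrA addrC subrKC addrC.
rewrite fy; apply: (@le_trans _ _
    (`|f (x + h) - f x| `^ p * W + `|f (x + h) - f y| `^ p * W)).
  rewrite -mulrDl ler_wpM2r ?powR_normB_le//.
  by rewrite /W divr_ge0 ?mulr_ge0 ?powR_ge0 ?exprn_ge0// mulr_ge0// ltW.
by rewrite lerD// -mulrA ler_wpM2l ?powR_ge0// -div1r.
Qed.

(** * Integration over the dyadic boxes *)

Section integral_bound.
Context {R : realType} {n : nat}.
Local Notation d := n.+1.
Local Notation mu := (lebesgue_rV R d).

(* Summing [increment_box_ge] over the dyadic boxes at scales 2^(k+1) |x - y|:
   they are disjoint, and the volume of each is a fixed multiple of scale^d. *)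
Lemma increment_integral_ge (p gamma : R) (f : 'rV[R]_d -> R)
    (x y : 'rV[R]_d) (K : nat) :
  0 < p -> measurable_fun [set: lebesgue_space R d] f ->
  0 < enorm (x - y) < 1 / 36 -> 5 * 4 ^+ K * enorm (x - y) <= 1 ->
  ((K%:R * (2 `^ (- p) * `|f x - f y| `^ p * (4^-1 `^ `|p * gamma - 1| *
     ln (1 / enorm (x - y)) `^ (p * gamma - 1) /
     (4 ^+ d * d%:R ^+ n))))%:E <=
   \int[mu]_(h in eball (1 / 3)) (increment gamma p f x h)%:E +
   \int[mu]_(h in eball (1 / 3)) (increment gamma p f y h)%:E)%E.
Proof.
move=> p0 mf r01 rK; have /andP[r0 r36] := r01.
(* The exponent k + 1 gives 2 r <= s already for k = 0; the last scale is then 2^K r, for which 5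
   s^2 <= r is exactly the hypothesis on [K]. *)
pose s k : R := 2 ^+ k.+1 * enorm (x - y).
have s0 k : 0 < s k by rewrite mulr_gt0// exprn_gt0.
have s2 k l : (k < l)%N -> 2 * s k <= s l.
  move=> kl; rewrite /s mulrA -exprS ler_pM2r//.
  by rewrite ler_weXn2l// ler1n.
have rs k : 2 * enorm (x - y) <= s k.
  by rewrite /s ler_pM2r// -[leLHS]expr1 ler_weXn2l// ler1n.
have sr k : (k < K)%N -> 5 * s k ^+ 2 <= enorm (x - y).
  move=> kK; rewrite /s exprMn -exprM mulnC exprM (_ : 2 ^+ 2 = 4 :> R); last by ring.
  have k4 : 4 ^+ k.+1 <= 4 ^+ K :> R by rewrite ler_weXn2l// ler1n.
  have e0 : 0 <= 4 ^+ k.+1 :> R by exact: exprn_ge0.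
  by nra.
set v := x - y.
pose A := 2 `^ (- p) * `|f x - f y| `^ p *
  (4^-1 `^ `|p * gamma - 1| * ln (1 / enorm v) `^ (p * gamma - 1)).
have A0 : 0 <= A by rewrite !mulr_ge0 ?powR_ge0.
pose a k := A / (4 * s k) ^+ d.
have a0 k : 0 <= a k by rewrite divr_ge0// exprn_ge0// mulr_ge0// ltW.
pose B : set (lebesgue_space R d) := eball (1 / 3).
pose tB : set (lebesgue_space R d) := (fun h => v + h) @^-1` B.
have mB : measurable B := measurable_eball _.
have mtB : measurable tB.
  by rewrite -[tB]setTI; exact: measurable_lebesgue_translate.
pose F z h := (increment gamma p f z h)%:E : \bar R.
have mF z : measurable_fun [set: lebesgue_space R d] (F z).
  by apply/measurable_EFinP; exact: measurable_increment.
have mtF z : measurable_fun [set: lebesgue_space R d] (fun h => F z (v + h)).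
  exact: measurableT_comp (mF z) (measurable_lebesgue_translate _ v).
have F0 z h : (0 <= F z h)%E by rewrite lee_fin increment_ge0.
(* After this translation both integrands are evaluated at the same [h], as in
   [increment_box_ge]. *)
rewrite [X in (_ <= _ + X)%E](ge0_integral_lebesgue_translate _ v _ _ mB); first last.
- by move=> h _; exact: F0.
- exact: measurable_funTS (mF y).
(* The domains [B] and [tB] differ, so both integrands are extended by zero before being added. *)
rewrite -/tB -/B integral_mkcond [X in (_ <= _ + X)%E]integral_mkcond.
have G0 : forall h, (0 <= (F x \_ B) h)%E by apply: erestrict_ge0.
have H0 : forall h, (0 <= ((fun h => F y (v + h)%R) \_ tB) h)%E.
  by apply: erestrict_ge0.
have mG : measurable_fun setT (F x \_ B).
  by apply/(measurable_restrictT _ mB); exact: measurable_funTS (mF x).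
have mH : measurable_fun setT ((fun h => F y (v + h)%R) \_ tB).
  by apply/(measurable_restrictT _ mtB); exact: measurable_funTS (mtF y).
rewrite -(ge0_integralD mu measurableT (fun h _ => G0 h) mG (fun h _ => H0 h) mH).
pose S k (h : 'rV[R]_d) := ((a k)%:E * (\1_(box (s k)) h)%:E : \bar R)%E.
have mS k : measurable_fun [set: lebesgue_space R d] (S k).
  apply: measurable_funeM; apply/measurable_EFinP.
  exact: measurable_indic (measurable_box (s k)).
have S0 k h : (0 <= S k h)%E by rewrite mule_ge0 ?lee_fin.
(* The minorant is a step function with the value [a k] on the k-th box. Each box contributes the
   same amount, since its volume cancels the scale in [a k]; hence the factor [K]. *)
apply: (@le_trans _ _ (\int[mu]_h \sum_(k <- iota 0 K) S k h)%E).
  rewrite ge0_integral_sum//.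
  rewrite (eq_bigr (fun=> (A / (4 ^+ d * d%:R ^+ n))%:E)) => [|k _].
    rewrite sumEFin big_const_seq count_predT size_iota iter_addr_0 lee_fin.
    by rewrite mulr_natl /A -!mulrA.
  have m1 : measurable_fun [set: lebesgue_space R d]
      (fun h => (\1_(box (s k)) h : R)%:E).
    by apply/measurable_EFinP; exact: measurable_indic (measurable_box (s k)).
  rewrite (ge0_integralZl_EFin mu measurableT (fun _ _ => _) m1 (a0 k)); last first.
    by move=> *; rewrite lee_fin.
  rewrite integral_indic//; last exact: measurable_box.
  rewrite setIT lebesgue_box// -EFinM /a exprMn; congr EFin.
  have : s k ^+ d != 0 by rewrite expf_neq0// gt_eqF.
  have : d%:R ^+ n != 0 :> R by rewrite expf_neq0// pnatr_eq0.
  have : 4 ^+ d != 0 :> R by rewrite expf_neq0.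
  by move: (4 ^+ d) (d%:R ^+ n) (s k ^+ d) => b e u b0 e0 u0; field; rewrite b0 e0 u0.
apply: (ge0_le_integral mu measurableT).
- by move=> h _; rewrite sume_ge0.
- exact: emeasurable_sum.
- exact: emeasurable_funD mG mH.
move=> h _ /=.
(* By disjointness, only the term of the box containing [h] survives; outside all boxes the sum is
   zero. *)
have [[k kK hk]|nh] := pselect (exists2 k, (k < K)%N & box (s k) h).
  have kiota : k \in iota 0 K by rewrite mem_iota.
  rewrite (bigD1_seq k)//= ?iota_uniq// big1_seq ?adde0 => [|l /andP[lk _]].
    have [Bh tBh le_a] :=
      increment_box_ge p gamma f x y h (s k) p0 r01 (rs k) (sr k kK) hk.
    rewrite /S indicE mem_set// mule1 !patchE !mem_set//.
    by rewrite -EFinD lee_fin /a /A -!mulrA; rewrite -!mulrA in le_a.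
  rewrite /S indicE memNset ?mule0// => hl.
  move: lk; rewrite neq_lt => /orP[/s2|/s2] sle.
    exact: box_disjoint sle hl hk.
  exact: box_disjoint sle hk hl.
rewrite big1_seq ?adde_ge0// => l /= ; rewrite mem_iota => lK.
by rewrite /S indicE memNset ?mule0// => hl; apply: nh; exists l.
Qed.

End integral_bound.

(** * From the integrated inequality to the pointwise estimate *)

Theorem theorem2p10 (R : realType) (d : nat) (p gamma : R) :
  (1 <= d)%N -> 0 < p -> 0 < gamma ->
  exists C : R, 0 < C /\
    forall f : 'rV[R]_d -> R, Xspace gamma p f ->
    forall x y : 'rV[R]_d, 0 < enorm (x - y) < 1 / 36 ->
      (`|f x - f y|%:E <=
       (C * ln (1 / enorm (x - y)) `^ (- gamma))%:E *
       (Lop gamma p f x + Lop gamma p f y))%E.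
Proof.
case: d => // n _ p0 g0.
have l4 : 0 < ln (4 : R) by apply: ln_gt0; lra.
(* The constants of [increment_integral_ge], with [K] replaced by its lower bound L / (4 log 4). *)
pose c : R := 2 `^ (- p) * 4^-1 `^ `|p * gamma - 1| /
  (4 ^+ n.+1 * n.+1%:R ^+ n) / (4 * ln 4).
have c0 : 0 < c.
  by rewrite !(divr_gt0, mulr_gt0) ?powR_gt0 ?exprn_gt0 ?invr_gt0 ?mulr_gt0// ?exprn_gt0.
exists ((2 / c) `^ (1 / p)); split; first by apply: powR_gt0; rewrite divr_gt0.
move=> f [mf _ _] x y r01; have /andP[r0 r36] := r01.
have [K [LK rK]] := exists_number_of_scales _ r01.
have := increment_integral_ge p gamma f x y K p0 mf r01 rK.
set L := ln (1 / enorm (x - y)) in LK *.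
have L0 : 0 < L by apply: ln_gt0; rewrite div1r invf_gt1//; lra.
rewrite /Lop.
set I := (\int[lebesgue_rV R n.+1]_(h in eball (1 / 3)) (increment gamma p f x h)%:E)%E.
set J := (\int[lebesgue_rV R n.+1]_(h in eball (1 / 3)) (increment gamma p f y h)%:E)%E.
move=> IJ.
have I0 : (0 <= I)%E by apply: integral_ge0 => h _; rewrite lee_fin increment_ge0.
have J0 : (0 <= J)%E by apply: integral_ge0 => h _; rewrite lee_fin increment_ge0.
set D := `|f x - f y| in IJ *.
have D0 : 0 <= D by exact: normr_ge0.
have {}IJ : ((c * L `^ (p * gamma) * D `^ p)%:E <= I + J)%E.
  apply: le_trans IJ; rewrite lee_fin.
  (* One factor [L] comes from the number of scales, the rest from the kernel. *)
  have -> : L `^ (p * gamma) = L * L `^ (p * gamma - 1).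
    rewrite -[X in _ = X * _](powRr1 (ltW L0)) -powRD ?subrKC//.
    by apply/implyP => _; rewrite gt_eqF.
  set E := L `^ (p * gamma - 1); have E0 : 0 <= E by exact: powR_ge0.
  have LK' : L / (4 * ln 4) <= K%:R by rewrite ler_pdivrMr ?mulr_gt0// mulrC.
  rewrite /c; move: LK' (mulr_gt0 (ltr0Sn R 3) l4); move: (4 * ln 4) => l LK' lgt0.
  have : 0 < 4 ^+ n.+1 * n.+1%:R ^+ n :> R by rewrite mulr_gt0// exprn_gt0.
  move: (_ * n.+1%:R ^+ n) => M M0.
  have := powR_ge0 2 (- p); have := powR_ge0 4^-1 `|p * gamma - 1|.
  have := powR_ge0 D p; move: (D `^ p) (_ `^ `|_|) (2 `^ - p) => Dp m q Dp0 m0 q0.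
  have W0 : 0 <= q * m * E * Dp / M by rewrite divr_ge0 ?mulr_ge0// ltW.
  rewrite [leLHS](_ : _ = q * m * E * Dp / M * (L / l)); last first.
    by field; rewrite !gt_eqF.
  rewrite [leRHS](_ : _ = q * m * E * Dp / M * K%:R); last first.
    by field; rewrite gt_eqF.
  exact: ler_wpM2l.
clearbody c I J.
(* Using I + J <= 2 max(I, J), whence the 2 in the constant, avoids subadditivity of the power 1/p,
   which fails for p < 1. *)
wlog JI : I J I0 J0 IJ / (J <= I)%E.
  move=> wl; have [|/ltW] := leP J I; first exact: wl.
  rewrite addeC => IJ'.
  by apply: wl => //; rewrite addeC.
have le2 : ((c / 2 * L `^ (p * gamma) * D `^ p)%:E <= I)%E.
  (* An infinite [I] makes the bound trivial. *)
  move: I I0 JI IJ => [i| |] // _ JI IJ; last by rewrite leey.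
  have := le_trans IJ (leeD2l i%:E JI).
  by rewrite -EFinD !lee_fin; lra.
have ip0 : 0 <= 1 / p by rewrite divr_ge0// ltW.
have pN0 : p != 0 by rewrite gt_eqF.
apply: (@le_trans _ _ (((2 / c) `^ (1 / p) * L `^ (- gamma))%:E * I `^ (1 / p))%E);
  last by rewrite lee_wpmul2l ?lee_fin ?mulr_ge0 ?powR_ge0// leeDl ?poweR_ge0.
apply: (@le_trans _ _ (((2 / c) `^ (1 / p) * L `^ (- gamma))%:E *
    (c / 2 * L `^ (p * gamma) * D `^ p)%:E `^ (1 / p))%E); last first.
  rewrite lee_wpmul2l ?lee_fin ?mulr_ge0 ?powR_ge0//.
  apply: gt0_ler_poweR => //; rewrite in_itv/= ?leey ?andbT//.
  by rewrite lee_fin ?mulr_ge0 ?powR_ge0 ?invr_ge0 ?(ltW c0).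
rewrite poweR_EFin -EFinM lee_fin.
have -> : (c / 2 * L `^ (p * gamma) * D `^ p) `^ (1 / p) =
    (c / 2) `^ (1 / p) * L `^ gamma * D.
  have ppK : p * (1 / p) = 1 by rewrite mulrC divfK.
  rewrite !powRM ?mulr_ge0 ?powR_ge0 ?invr_ge0 ?(ltW c0)// -!powRrM.
  by rewrite [p * gamma * _]mulrAC ppK [1 * gamma]mul1r powRr1.
have AA : (2 / c) `^ (1 / p) * (c / 2) `^ (1 / p) = 1.
  rewrite -powRM ?divr_ge0// ?(ltW c0)// (_ : _ * _ = 1) ?powR1//.
  by field; rewrite gt_eqF.
have BB : L `^ (- gamma) * L `^ gamma = 1.
  by rewrite powRN mulVf// gt_eqF// powR_gt0.
by rewrite mulrA (mulrACA ((2 / c) `^ (1 / p))) AA BB !mul1r.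
Qed.
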